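(* Let $K$ be a finite regular CW complex, $L$ a subcomplex of $K$, and $f:L\to\mathbb{R}^k$ a multidimensional discrete Morse (MDM) function on $L$. Then $f$ can be extended to an MDM function $g:K\to\mathbb{R}^k$ on $K$ (i.e. $g|_L=f$) such that each cell in $K\setminus L$ is critical for $g$.
   Context: A finite regular CW complex $K$ is identified with its set of open cells; $K_p$ is the set of $p$-cells. For distinct cells, $\sigma\subset\tau$ means that $\sigma$ is contained in the closure of $\tau$. On $\mathbb{R}^k$, $a\preceq b$ means $a_i\le b_i$ for all $i$, and $a\prec b$ means $a\preceq b$ and $a\ne b$. For $f:K\to\mathbb{R}^k$ (a function on cells) and $\sigma\in K_p$, put $H_f(\sigma)=\{\beta\in K_{p+1}:\beta\supset\sigma,\ f(\beta)\preceq f(\sigma)\}$ and $T_f(\sigma)=\{\alpha\in K_{p-1}:\alpha\subset\sigma,\ f(\alpha)\succeq f(\sigma)\}$. $f$ is an MDM function on $K$ if for every $p$ and every $\sigma\in K_p$: (1) $|H_f(\sigma)|\le 1$; (2) $|T_f(\sigma)|\le1$; (3) if $\beta\in K_{p+1}$, $\beta\supset\sigma$, $\beta\notin H_f(\sigma)$, then $f(\beta)\succ f(\sigma)$; (4) if $\alpha\in K_{p-1}$, $\alpha\subset\sigma$, $\alpha\notin T_f(\sigma)$, then $f(\alpha)\prec f(\sigma)$. A cell $\sigma$ is critical for $f$ if $|H_f(\sigma)|=|T_f(\sigma)|=0$. For a function on the cells of a subcomplex $L$, the same definitions are used with $L$ in place of $K$. *)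

(* Defs.v *)
From HB Require Import structures.
From mathcomp Require Import all_boot all_order all_algebra.
From mathcomp Require Import all_classical all_reals all_analysis.
Set Implicit Arguments. Unset Strict Implicit. Unset Printing Implicit Defensive.
Import Order.TTheory GRing.Theory Num.Theory.
Import numFieldNormedType.Exports.
Local Open Scope classical_set_scope.
Local Open Scope ring_scope.

(* Euclidean discs; the norm of 'rV[R]_n in the library is the sup norm. *)
Definition sqnorm (R : realType) (n : nat) (x : 'rV[R]_n) : R :=
  \sum_(i < n) x 0 i ^+ 2.
Definition closed_disc (R : realType) (n : nat) : set 'rV[R]_n :=
  [set x | sqnorm x <= 1].
Definition open_disc (R : realType) (n : nat) : set 'rV[R]_n :=
  [set x | sqnorm x < 1].
Definition sphere (R : realType) (n : nat) : set 'rV[R]_n :=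
  [set x | sqnorm x = 1].

Definition homeo_onto (X Y : topologicalType) (A : set X) (B : set Y)
    (phi : X -> Y) : Prop :=
  [/\ phi @` A = B, {within A, continuous phi} &
      exists psi : Y -> X,
        {within B, continuous psi} /\ {in A, cancel phi psi}].

(* The carrier indexes the open cells, which are the sets [cw_cell c]; since
   they are nonempty and disjoint, indices and cells correspond bijectively.
   Finitely many cells make closure-finiteness and the weak topology
   automatic. *)
Record finRegCW (R : realType) := FinRegCW {
  cw_index :> finType;
  cw_space : topologicalType;
  cw_dim : cw_index -> nat;
  cw_cell : cw_index -> set cw_space;
  cw_hausdorff : hausdorff_space cw_space;
  cw_cover : \bigcup_c cw_cell c = setT;
  cw_disjoint : forall c d, c != d -> cw_cell c `&` cw_cell d = set0;
  cw_char : forall c, exists phi : 'rV[R]_(cw_dim c) -> cw_space,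
    [/\ homeo_onto (@closed_disc R (cw_dim c)) (closure (cw_cell c)) phi,
        phi @` @open_disc R (cw_dim c) = cw_cell c &
        phi @` @sphere R (cw_dim c) `<=`
          \bigcup_(d in [set d | (cw_dim d < cw_dim c)%N]) cw_cell d] }.

Definition cw_face (R : realType) (K : finRegCW R) : rel K :=
  fun s t => (s != t) && `[< cw_cell s `<=` closure (cw_cell t) >].

Definition subcomplex (R : realType) (K : finRegCW R) (L : {set K}) : Prop :=
  closed (\bigcup_(c in [set c | c \in L]) cw_cell c).

Definition vle (R : realType) (k : nat) (a b : 'rV[R]_k) : bool :=
  [forall i, a 0 i <= b 0 i].
Definition vlt (R : realType) (k : nat) (a b : 'rV[R]_k) : bool :=
  vle a b && (a != b).

(* Stated for any finite set [C] of cells with its dimension function and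
   face relation, so as to apply both to a complex and to a subcomplex. *)
Section MDM.
Variables (R : realType) (k : nat) (C : finType).
Variables (dim : C -> nat) (face : rel C) (f : C -> 'rV[R]_k).

Definition Hset (s : C) : {set C} :=
  [set b | [&& dim b == (dim s).+1, face s b & vle (f b) (f s)]].
Definition Tset (s : C) : {set C} :=
  [set a | [&& (dim a).+1 == dim s, face a s & vle (f s) (f a)]].

Definition is_mdm : Prop := forall s : C,
  [/\ (#|Hset s| <= 1)%N, (#|Tset s| <= 1)%N,
      forall b, dim b = (dim s).+1 -> face s b -> b \notin Hset s ->
        vlt (f s) (f b) &
      forall a, (dim a).+1 = dim s -> face a s -> a \notin Tset s ->
        vlt (f a) (f s)].

Definition is_critical (s : C) : Prop := #|Hset s| = 0%N /\ #|Tset s| = 0%N.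
End MDM.

Definition cw_mdm (R : realType) (k : nat) (K : finRegCW R)
    (g : K -> 'rV[R]_k) : Prop :=
  is_mdm (@cw_dim R K) (@cw_face R K) g.

Definition cw_critical (R : realType) (k : nat) (K : finRegCW R)
    (g : K -> 'rV[R]_k) (s : K) : Prop :=
  is_critical (@cw_dim R K) (@cw_face R K) g s.

(* The union of the cells of L being closed, closures of cells of L may be
   taken in the ambient space. *)
Definition sub_mdm (R : realType) (k : nat) (K : finRegCW R) (L : {set K})
    (f : {c : K | c \in L} -> 'rV[R]_k) : Prop :=
  is_mdm (fun c : {c : K | c \in L} => cw_dim (val c))
         (fun a b : {c : K | c \in L} => cw_face (val a) (val b)) f.

(* Main.v *)
Require Import Defs.
From HB Require Import structures.
From mathcomp Require Import all_boot all_order all_algebra.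
From mathcomp Require Import all_classical all_reals all_analysis.
Import Order.TTheory GRing.Theory Num.Theory.
Local Open Scope ring_scope.

(* On the cells outside [L] let [g] be the constant vector with entries
   [M + dim s], where [M] bounds all entries of [f]. Since [L] is closed under
   taking faces, a facet relation involving a cell outside [L] has its larger
   cell outside [L], and [g] increases strictly along it; all other facet
   relations live in [L], where [g = f]. *)

(** Vectors without coordinates would coincide; the coordinate supplied by [0 < k] tells [a] and [b]
    apart. *)
Lemma vlt_all_lt (R : realType) (k : nat) (a b : 'rV[R]_k) :
  (0 < k)%N -> (forall i, a 0 i < b 0 i) -> vlt a b.
Proof.
move=> k_gt0 ltab; apply/andP; split; first by apply/forallP => i; exact: ltW.
apply/eqP => eqab; have := ltab (Ordinal k_gt0).
by rewrite eqab ltxx.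
Qed.

Lemma vlt_vleF (R : realType) (k : nat) (a b : 'rV[R]_k) :
  vlt a b -> vle b a = false.
Proof.
case/andP => /forallP leab neqab; apply/negP => /forallP leba.
case/eqP: neqab; apply/rowP => i; apply/eqP.
by rewrite eq_le leab leba.
Qed.

Lemma entries_bounded (R : realType) (k : nat) (C : finType)
    (f : C -> 'rV[R]_k) : exists M : R, forall c i, f c 0 i <= M.
Proof.
(* A sum of absolute values dominates each of its terms, and it makes sense even when there are no
   entries. *)
exists (\sum_(p : C * 'I_k) `|f p.1 0 p.2|) => c i.
apply: (le_trans (ler_norm _)).
by rewrite (bigD1 (c, i)) //= lerDl sumr_ge0.
Qed.

Section Extension.
Variables (R : realType) (k : nat) (C : finType) (dim : C -> nat).
Variables (face : rel C) (L : {set C}) (f : {c : C | c \in L} -> 'rV[R]_k).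
Variable g : C -> 'rV[R]_k.

Hypothesis face_closed : forall s t, face s t -> t \in L -> s \in L.
Hypothesis f_mdm :
  is_mdm (fun c : {c : C | c \in L} => dim (val c))
         (fun a b : {c : C | c \in L} => face (val a) (val b)) f.
Hypothesis g_val : forall c, g (val c) = f c.
Hypothesis g_lt : forall s t, dim t = (dim s).+1 -> face s t -> t \notin L ->
  vlt (g s) (g t).

(** For [b] outside [L], [g_lt] would contradict [vle (g b) (g s)]. As [s] is arbitrary, this serves
    for cells inside and outside [L]. *)
Lemma Hset_extension_in (s b : C) : b \in Hset dim face g s -> b \in L.
Proof.
rewrite inE => /and3P[/eqP db fb leb]; apply/negPn/negP => bL.
by rewrite (vlt_vleF _ _ _ _ (g_lt _ _ db fb bL)) in leb.
Qed.

Lemma Tset_extension_out (s : C) : s \notin L -> Tset dim face g s = finset.set0.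
Proof.
move=> sL; apply/setP => a; rewrite !inE; apply/negbTE/negP.
case/and3P => /eqP/esym da fa.
by rewrite (vlt_vleF _ _ _ _ (g_lt _ _ da fa sL)).
Qed.

Lemma Hset_extension_out (s : C) : s \notin L -> Hset dim face g s = finset.set0.
Proof.
move=> sL; apply/setP => b; rewrite [RHS]inE; apply/negbTE/negP => Hb.
case/negP: sL; apply: (face_closed _ _ _ (Hset_extension_in _ _ Hb)).
by move: Hb; rewrite inE => /and3P[].
Qed.

(** A cell of [L] may gain cofaces in [C], but by [Hset_extension_in] none of them enters the
    set. *)
Lemma Hset_extension_val (s : {c : C | c \in L}) :
  Hset dim face g (val s) =
  val @: Hset (fun c : {c : C | c \in L} => dim (val c))
           (fun a b : {c : C | c \in L} => face (val a) (val b)) f s.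
Proof.
apply/setP => b; apply/idP/imsetP => [Hb|[b' Hb ->]]; last first.
  by move: Hb; rewrite !inE !g_val.
have bL := Hset_extension_in _ _ Hb; exists (Sub b bL) => //.
by move: Hb; rewrite !inE -!g_val.
Qed.

(** Faces of a cell of [L] lie in [L], so [C] offers no new candidates. *)
Lemma Tset_extension_val (s : {c : C | c \in L}) :
  Tset dim face g (val s) =
  val @: Tset (fun c : {c : C | c \in L} => dim (val c))
           (fun a b : {c : C | c \in L} => face (val a) (val b)) f s.
Proof.
apply/setP => a; apply/idP/imsetP => [Ta|[a' Ta ->]]; last first.
  by move: Ta; rewrite !inE !g_val.
have aL : a \in L.
  by move: Ta; rewrite inE => /and3P[_ /face_closed/(_ (valP s))].
exists (Sub a aL) => //.
by move: Ta; rewrite !inE -!g_val.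
Qed.

Lemma is_critical_extension (s : C) : s \notin L -> is_critical dim face g s.
Proof.
by move=> sL; split; rewrite ?Hset_extension_out ?Tset_extension_out ?cards0.
Qed.

Lemma is_mdm_extension : is_mdm dim face g.
Proof.
move=> s; have [sL|sL] := boolP (s \in L); last first.
  have [H0 T0] := is_critical_extension _ sL.
  (* Both strict inequalities come from [g_lt]: the larger cell is outside [L], in the case of [b]
     because its face [s] is. *)
  rewrite H0 T0; split=> // [b db fb _|a /esym da fa _]; last exact: g_lt.
  by apply: g_lt => //; apply: contra sL; exact: face_closed.
have [s' ->] : exists s' : {c : C | c \in L}, s = val s' by exists (Sub s sL).
rewrite Hset_extension_val Tset_extension_val !(card_imset _ val_inj).
have [Hle Tle Hlt Tlt] := f_mdm s'; split=> // [b db fb nHb|a da fa nTa].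
  (* A coface outside [L] is handled by [g_lt]; one inside is written as a [val], so that the
     condition on [f] applies. *)
  have [bL|bL] := boolP (b \in L); last exact: g_lt.
  rewrite g_val -[b]/(val (Sub b bL : {c : C | c \in L})) g_val.
  by apply: Hlt => //; apply: contra nHb => Hb; apply/imsetP; exists (Sub b bL).
have aL : a \in L := face_closed _ _ fa (valP s').
rewrite g_val -[a]/(val (Sub a aL : {c : C | c \in L})) g_val.
by apply: Tlt => //; apply: contra nTa => Ta; apply/imsetP; exists (Sub a aL).
Qed.

End Extension.

Lemma cw_cell_nonempty (R : realType) (K : finRegCW R) (c : K) :
  (cw_cell c !=set0)%classic.
Proof.
have [phi [_ <- _]] := cw_char c.
(* The image of the centre of the disc lies in the cell. *)
exists (phi 0), 0 => //; rewrite /open_disc /sqnorm /=.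
by rewrite big1 ?ltr01 // => i _; rewrite mxE expr0n.
Qed.

(** The closed union of the cells of [L] contains the closure of [t], hence a point of [s]. That
    point lies in some cell [d] of [L], and disjointness forces [d = s]. *)
Lemma subcomplex_face (R : realType) (K : finRegCW R) (L : {set K}) :
  subcomplex L -> forall s t : K, cw_face s t -> t \in L -> s \in L.
Proof.
move=> hL s t /andP[_ /asboolP st] tL.
have [x sx] := cw_cell_nonempty R K s.
have [d dL dx] : (\bigcup_(c in [set c | c \in L]) cw_cell c)%classic x.
  rewrite [X in X x](closure_id _).1 //; apply: closure_subset (st _ sx).
  exact: bigcup_sup.
have [->//|sd] := eqVneq s d.
by have : (cw_cell s `&` cw_cell d)%classic x by []; rewrite (cw_disjoint sd).
Qed.

Theorem lemma2p10 (R : realType) (K : finRegCW R) (L : {set K})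
    (hL : subcomplex L) (k : nat) (hk : (0 < k)%N)
    (f : {c : K | c \in L} -> 'rV[R]_k) (hf : sub_mdm f) :
  exists g : K -> 'rV[R]_k,
    [/\ forall c : {c : K | c \in L}, g (val c) = f c,
        cw_mdm g &
        forall s : K, s \notin L -> cw_critical g s].
Proof.
have [M fM] := entries_bounded _ _ _ f.
pose g (s : K) : 'rV[R]_k :=
  if insub s is Some c then f c else const_mx (M + (cw_dim s)%:R).
have g_val (c : {c : K | c \in L}) : g (val c) = f c by rewrite /g valK.
have g_lt (s t : K) : cw_dim t = (cw_dim s).+1 -> cw_face s t -> t \notin L ->
    vlt (g s) (g t).
  move=> dt _ tL; apply: vlt_all_lt => // i.
  rewrite /g [insub t]insubN // mxE dt.
  (* For [s] in [L], the entry of [f] is at most [M], and the dimension of [t] is at least 1, which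
     makes the inequality strict. For [s] outside [L], the dimensions are compared. *)
  case: insubP => [c _ _|_]; last by rewrite mxE ltrD2l ltr_nat.
  by rewrite (le_lt_trans (fM c i)) // ltrDl ltr0Sn.
have face_closed := subcomplex_face _ _ _ hL.
exists g; split=> //; first exact: is_mdm_extension face_closed hf g_val g_lt.
exact: is_critical_extension face_closed g_lt.
Qed.
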